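(* Let $G_1,G_2,G_k$ be generators over $\Sigma_1,\Sigma_2,\Sigma_k$, respectively, with $\Sigma_1\cap\Sigma_2\subseteq\Sigma_k\subseteq\Sigma_1\cup\Sigma_2$, and put $L=L(G_1\| G_2\| G_k)$. Let $K\subseteq L_m(G_1\| G_2\| G_k)$ be a specification such that both $K$ and its prefix closure $\overline{K}$ are conditionally decomposable with respect to $\Sigma_1,\Sigma_2,\Sigma_k$. Define \[ \sup CN_k=\sup CN(P_k(K),L(G_k),\Sigma_{k,u},Q_k),\qquad \sup CN_{i+k}=\sup CN\big(P_{i+k}(K),\,L(G_i)\parallel\overline{\sup CN_k},\,\Sigma_{i+k,u},\,Q_{i+k}\big),\quad i=1,2. \] Assume that $\sup CN_{1+k}$ and $\sup CN_{2+k}$ are nonconflicting and that $P^{1+k}_k(\sup CN_{1+k})\cap P^{2+k}_k(\sup CN_{2+k})$ is controllable and normal with respect to $L(G_k)$, $\Sigma_{k,u}$, and $Q_k$. Then \[ \sup CN_{1+k}\parallel\sup CN_{2+k}=\sup cCN\big(K,L,(\Sigma_{1,u},\Sigma_{2,u},\Sigma_{k,u}),(Q_{1+k},Q_{2+k},Q_k)\big). \]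
   Context: An event set is a finite nonempty set $\Sigma$; a language over $\Sigma$ is a subset of the set $\Sigma^*$ of finite words, and the specification $K$ is a regular language. $\overline{L}$ denotes the prefix closure of $L$. A generator over $\Sigma$ is $G=(Q,\Sigma,f,q_0,Q_m)$ with finite nonempty state set $Q$, partial transition function $f:Q\times\Sigma\to Q$ (extended to words), initial state $q_0$, marked states $Q_m\subseteq Q$; $L(G)=\{s\in\Sigma^*: f(q_0,s)\text{ is defined}\}$ and $L_m(G)=\{s\in\Sigma^*: f(q_0,s)\in Q_m\}$. For $\Sigma_0\subseteq\Sigma$, the projection $\Sigma^*\to\Sigma_0^*$ is the homomorphism erasing events outside $\Sigma_0$ and fixing those in $\Sigma_0$. For $L_i\subseteq\Sigma_i^*$, $L_1\parallel L_2=\{w\in(\Sigma_1\cup\Sigma_2)^*: P_i(w)\in L_i,\ i=1,2\}$, where $P_i$ is the projection to $\Sigma_i^*$. $G_1\|G_2$ is the parallel composition, with $L(G_1\|G_2)=L(G_1)\parallel L(G_2)$ and $L_m(G_1\|G_2)=L_m(G_1)\parallel L_m(G_2)$. Languages $L_1,L_2$ are nonconflicting if $\overline{L_1\parallel L_2}=\overline{L_1}\parallel\overline{L_2}$. The set $\Sigma_1\cup\Sigma_2$ is partitioned into controllable events $\Sigma_c$ and uncontrollable events $\Sigma_u$, and $\Sigma_o\subseteq\Sigma_1\cup\Sigma_2$ is the set of observable events. Notation, for $i=1,2$: $\Sigma_{i+k}=\Sigma_i\cup\Sigma_k$; for $j\in\{1,2,k,1+k,2+k\}$, $\Sigma_{j,u}=\Sigma_j\cap\Sigma_u$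 and $\Sigma_{j,o}=\Sigma_j\cap\Sigma_o$; $P_k:(\Sigma_1\cup\Sigma_2)^*\to\Sigma_k^*$, $P_{i+k}:(\Sigma_1\cup\Sigma_2)^*\to\Sigma_{i+k}^*$, $P^{i+k}_k:\Sigma_{i+k}^*\to\Sigma_k^*$ and $Q_j:\Sigma_j^*\to\Sigma_{j,o}^*$, $j\in\{1+k,2+k,k\}$, are projections. $K$ is conditionally decomposable with respect to $\Sigma_1,\Sigma_2,\Sigma_k$ if $K=P_{1+k}(K)\parallel P_{2+k}(K)$. A language $M$ is controllable with respect to prefix-closed $L$ and $\Sigma'_u$ if $\overline{M}\Sigma'_u\cap L\subseteq\overline{M}$. $M$ is normal with respect to prefix-closed $L$ and a projection $Q$ if $\overline{M}=Q^{-1}Q(\overline{M})\cap L$. $\sup CN(K,L,\Sigma'_u,Q)$ denotes the supremal controllable and normal sublanguage of $K$: the union (which itself has both properties) of all $M\subseteq K\cap L$ that are controllable with respect to $L$ and $\Sigma'_u$ and normal with respect to $L$ and $Q$. A language $M\subseteq L_m(G_1\|G_2\|G_k)$ is conditionally controllable if $P_k(M)$ is controllable with respect to $L(G_k)$ and $\Sigma_{k,u}$, and for $i=1,2$, $P_{i+k}(M)$ is controllable with respect to $L(G_i)\parallel\overline{P_k(M)}$ and $\Sigma_{i+k,u}$. It is conditionally normal if $P_k(M)$ is normal with respect to $L(G_k)$ and $Q_k$, and for $i=1,2$, $P_{i+k}(M)$ is normal with respect to $L(G_i)\parallel\overline{P_k(M)}$ and $Q_{i+k}$. $\sup cCN(K,L,(\Sigma_{1,u},\Sigma_{2,u},\Sigma_{k,u}),(Q_{1+k},Q_{2+k},Q_k))$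 is the supremal conditionally controllable and conditionally normal sublanguage of $K$, i.e. the union (which itself has both properties) of all $M\subseteq K$ that are both conditionally controllable and conditionally normal. *)

(* Defs.v *)
From HB Require Import structures.
From mathcomp Require Import all_boot.
From mathcomp Require Import boolp classical_sets.

Set Implicit Arguments.
Unset Strict Implicit.
Unset Printing Implicit Defensive.

Local Open Scope classical_set_scope.

(* All event sets are subsets [S] of one ambient finite type [E] of events;
   words are elements of [seq E], and a language is a set of words. *)

Definition words (E : finType) (S : {set E}) : set (seq E) :=
  [set w | all (mem S) w].

Definition proj (E : finType) (S : {set E}) (w : seq E) : seq E :=
  [seq e <- w | e \in S].

Definition pclosure (E : finType) (M : set (seq E)) : set (seq E) :=
  [set s | exists t, M (s ++ t)].

(* The alphabets of [M1] and [M2] are explicit arguments, since they cannot be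
   recovered from the languages. *)
Definition lpar (E : finType) (S1 S2 : {set E}) (M1 M2 : set (seq E)) :
    set (seq E) :=
  words (S1 :|: S2) `&` [set w | M1 (proj S1 w) /\ M2 (proj S2 w)].

Definition nonconflicting (E : finType) (S1 S2 : {set E})
    (M1 M2 : set (seq E)) : Prop :=
  pclosure (lpar S1 S2 M1 M2) = lpar S1 S2 (pclosure M1) (pclosure M2).

(* [trans_dom] makes [trans] a partial function on [state * S]. *)
Record generator (E : finType) (S : {set E}) := Generator {
  state : finType;
  trans : state -> E -> option state;
  init : state;
  marked : {set state};
  trans_dom : forall q e, e \notin S -> trans q e = None
}.

Fixpoint run (E : finType) (S : {set E}) (G : generator S) (q : state G)
    (w : seq E) : option (state G) :=
  if w is e :: w' then obind (fun q' => run q' w') (trans q e) else Some q.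

Definition lang (E : finType) (S : {set E}) (G : generator S) : set (seq E) :=
  [set w | exists q, run (init G) w = Some q].

Definition mlang (E : finType) (S : {set E}) (G : generator S) : set (seq E) :=
  [set w | exists2 q, run (init G) w = Some q & q \in marked G].

Definition regular_lang (E : finType) (S : {set E}) (M : set (seq E)) : Prop :=
  exists G : generator S, M = mlang G.

Definition local_step (E : finType) (S : {set E}) (G : generator S)
    (q : state G) (e : E) : option (state G) :=
  if e \in S then trans q e else Some q.

Definition gpar_trans (E : finType) (S1 S2 : {set E})
    (G1 : generator S1) (G2 : generator S2)
    (q : state G1 * state G2) (e : E) : option (state G1 * state G2) :=
  if e \in S1 :|: S2 then
    if (local_step q.1 e, local_step q.2 e) is (Some q1, Some q2)
    then Some (q1, q2) else None
  else None.

Lemma gpar_trans_dom (E : finType) (S1 S2 : {set E})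
    (G1 : generator S1) (G2 : generator S2)
    (q : state G1 * state G2) (e : E) :
  e \notin S1 :|: S2 -> gpar_trans q e = None.
Proof. by rewrite /gpar_trans => /negbTE ->. Qed.

Definition gpar (E : finType) (S1 S2 : {set E})
    (G1 : generator S1) (G2 : generator S2) : generator (S1 :|: S2) :=
  @Generator E (S1 :|: S2) (state G1 * state G2)%type
    (@gpar_trans E S1 S2 G1 G2) (init G1, init G2)
    (finset.setX (marked G1) (marked G2)) (@gpar_trans_dom E S1 S2 G1 G2).

Lemma run_gpar (E : finType) (S1 S2 : {set E})
    (G1 : generator S1) (G2 : generator S2)
    (w : seq E) (q r : state G1 * state G2) :
  @run _ _ (gpar G1 G2) q w = Some r <->
  [/\ words (S1 :|: S2) w, run q.1 (proj S1 w) = Some r.1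
    & run q.2 (proj S2 w) = Some r.2].
Proof.
rewrite /words /=; elim: w q => [|e w IH] [q1 q2] /=.
  by case: r => r1 r2 /=; split=> [[-> ->]|[_ [->] [->]]].
rewrite /gpar_trans /local_step /=.
case: (boolP (e \in S1 :|: S2)) => [|_]; last by split=> [|[]].
rewrite inE; case: (e \in S1); case: (e \in S2) => //= _.
- case: (trans q1 e) => [p1|] /=; last by split=> [|[]].
  case: (trans q2 e) => [p2|] /=; [exact: IH | by split=> [|[]]].
- case: (trans q1 e) => [p1|] /=; [exact: IH | by split=> [|[]]].
- case: (trans q2 e) => [p2|] /=; [exact: IH | by split=> [|[]]].
Qed.

Lemma lang_gpar (E : finType) (S1 S2 : {set E})
    (G1 : generator S1) (G2 : generator S2) :
  lang (gpar G1 G2) = lpar S1 S2 (lang G1) (lang G2).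
Proof.
apply/seteqP; split=> w.
  by case=> r /run_gpar [Sw r1 r2]; split=> //; split; eexists; eassumption.
by case=> Sw [[q1 r1] [q2 r2]]; exists (q1, q2); apply/run_gpar.
Qed.

Lemma mlang_gpar (E : finType) (S1 S2 : {set E})
    (G1 : generator S1) (G2 : generator S2) :
  mlang (gpar G1 G2) = lpar S1 S2 (mlang G1) (mlang G2).
Proof.
apply/seteqP; split=> w.
  case=> r /run_gpar [Sw r1 r2]; rewrite inE => /andP[m1 m2].
  by split=> //; split; eexists; eassumption.
case=> Sw [[q1 r1 m1] [q2 r2 m2]]; exists (q1, q2); first exact/run_gpar.
by rewrite inE /= m1 m2.
Qed.

Definition controllable (E : finType) (M L : set (seq E)) (Su : {set E}) :
    Prop :=
  [set rcons s u | s in pclosure M & u in [set` Su]] `&` L `<=` pclosure M.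

Definition normal (E : finType) (M L : set (seq E)) (Q : seq E -> seq E) :
    Prop :=
  pclosure M = Q @^-1` (Q @` pclosure M) `&` L.

Definition supCN (E : finType) (K L : set (seq E)) (Su : {set E})
    (Q : seq E -> seq E) : set (seq E) :=
  \bigcup_(M in [set M | [/\ M `<=` K `&` L, controllable M L Su
                           & normal M L Q]]) M.

Definition cond_decomposable (E : finType) (S1 S2 Sk : {set E})
    (K : set (seq E)) : Prop :=
  K = lpar (S1 :|: Sk) (S2 :|: Sk)
        (proj (S1 :|: Sk) @` K) (proj (S2 :|: Sk) @` K).

Definition cond_controllable (E : finType) (S1 S2 Sk Su : {set E})
    (G1 : generator S1) (G2 : generator S2) (Gk : generator Sk)
    (M : set (seq E)) : Prop :=
  [/\ controllable (proj Sk @` M) (lang Gk) (Sk :&: Su),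
      controllable (proj (S1 :|: Sk) @` M)
        (lpar S1 Sk (lang G1) (pclosure (proj Sk @` M)))
        ((S1 :|: Sk) :&: Su)
    & controllable (proj (S2 :|: Sk) @` M)
        (lpar S2 Sk (lang G2) (pclosure (proj Sk @` M)))
        ((S2 :|: Sk) :&: Su)].

Definition cond_normal (E : finType) (S1 S2 Sk So : {set E})
    (G1 : generator S1) (G2 : generator S2) (Gk : generator Sk)
    (M : set (seq E)) : Prop :=
  [/\ normal (proj Sk @` M) (lang Gk) (proj (Sk :&: So)),
      normal (proj (S1 :|: Sk) @` M)
        (lpar S1 Sk (lang G1) (pclosure (proj Sk @` M)))
        (proj ((S1 :|: Sk) :&: So))
    & normal (proj (S2 :|: Sk) @` M)
        (lpar S2 Sk (lang G2) (pclosure (proj Sk @` M)))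
        (proj ((S2 :|: Sk) :&: So))].

(* The plant language [L(G1 || G2 || Gk)] is not a separate argument:
   conditional controllability and normality refer to the three generators,
   and these determine it. *)
Definition supcCN (E : finType) (S1 S2 Sk Su So : {set E})
    (G1 : generator S1) (G2 : generator S2) (Gk : generator Sk)
    (K : set (seq E)) : set (seq E) :=
  \bigcup_(M in [set M | [/\ M `<=` K, M `<=` mlang (gpar (gpar G1 G2) Gk),
                            cond_controllable Su G1 G2 Gk M
                          & cond_normal So G1 G2 Gk M]]) M.

(* Main.v *)
Require Import Defs.
From mathcomp Require Import all_boot.
From mathcomp Require Import boolp classical_sets.

Set Implicit Arguments.
Unset Strict Implicit.
Unset Printing Implicit Defensive.

Local Open Scope classical_set_scope.

(** Write [Ti] for [Si :|: Sk], [Ai] for the local supremal languages and [M]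
    for their parallel composition.  The alphabets [T1] and [T2] meet exactly
    in [Sk].

    The composition lies in the supremum.  Conditional decomposability of [K]
    gives that [M] is included in [K].  Words of [A1] and [A2] with the same
    projection to [Sk] can be shuffled into one word ([shuffle_words]), so
    that the projection of [M] to [Sk] is the intersection in the hypotheses;
    hence it is controllable and normal.  Shuffling words of the two prefix
    closures, which compose to the prefix closure of [M] because the [Ai] are
    nonconflicting, shows that a word belongs to the closure of the
    projection of [M] to [Ti] exactly when it belongs to the closure of [Ai]
    and its trace on [Sk] to the closure of the projection of [M]
    ([pclosure_proj_lparl], [pclosure_proj_lparr]).  The plant in the
    conditional properties of [M] is likewise the plant used for [Ai],
    restricted to the words with such a trace.  Controllability and normality
    are inherited by such a simultaneous restriction
    ([controllable_restrict], [normal_restrict]).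

    The composition contains the supremum.  Let [M] be conditionally
    controllable and conditionally normal.  Its projection to [Sk] is a
    competitor for the coordinator supremum [N].  Its projection to [Ti] is
    controllable and normal with respect to the plant of [Gi] constrained by
    the projection of [M] to [Sk]; both properties extend to the larger plant
    constrained by [N], because the projection of [M] to [Sk] is itself
    controllable and normal with respect to the language of [Gk]
    ([controllable_coordinator], [normal_coordinator]).  So the projection of
    [M] to [Ti] is a competitor for [Ai], and every word of [M] has its
    projections to [T1] and [T2] in [A1] and [A2]. *)

(** * Projections and prefix closures *)

Lemma proj_sub (E : finType) (A B : {set E}) (w : seq E) :
  A \subset B -> proj A (proj B w) = proj A w.
Proof.
move=> AB; rewrite /proj -filter_predI; apply: eq_filter => e /=.
by case: (boolP (e \in A)) => //= /(fintype.subsetP AB) ->.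
Qed.

Lemma proj_rcons (E : finType) (A : {set E}) (w : seq E) (u : E) :
  proj A (rcons w u) = if u \in A then rcons (proj A w) u else proj A w.
Proof. by rewrite /proj filter_rcons. Qed.

Lemma pclosure_ext (E : finType) (M : set (seq E)) : M `<=` pclosure M.
Proof. by move=> w Mw; exists [::]; rewrite cats0. Qed.

Lemma pclosure_mono (E : finType) (M N : set (seq E)) :
  M `<=` N -> pclosure M `<=` pclosure N.
Proof. by move=> MN w [t Mt]; exists t; exact: MN. Qed.

Lemma pclosure_proj (E : finType) (A : {set E}) (M : set (seq E)) :
  pclosure (proj A @` M) = proj A @` pclosure M.
Proof.
apply/seteqP; split=> s; last first.
  case=> w [t Mt] <-; exists (proj A t); exists (w ++ t) => //.
  exact: filter_cat.
case=> t [w Mw]; elim: w s M Mw => [|e w IH] s M Mw /=.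
  case: s => // _; exists [::] => //; by exists [::].
case: s => [_|f s].
  by exists [::] => //; exists (e :: w).
case: (boolP (e \in A)) => eA /= eq_w.
  case: eq_w => <- /(IH s [set v | M (e :: v)] Mw)[v [r Mr] <-].
  by exists (e :: v); [exists r | rewrite /= eA].
have [v [r Mr] <-] := IH (f :: s) [set v | M (e :: v)] Mw eq_w.
by exists (e :: v); [exists r | rewrite /= (negbTE eA)].
Qed.

(** Events outside the common alphabet are inserted greedily; the next common
    event is emitted once it heads both words, where the equality of traces
    makes the two heads agree. *)
Lemma shuffle_words (E : finType) (A B : {set E}) (s t : seq E) :
    words A s -> words B t -> proj (A :&: B) s = proj (A :&: B) t ->
  exists w, [/\ words (A :|: B) w, proj A w = s & proj B w = t].
Proof.
rewrite /words /=; elim: s t => [|e s IHs] t.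
  move=> _; elim: t => [|f t IHt] /=; first by exists [::].
  case/andP=> fB tB; rewrite inE fB andbT.
  case: (boolP (f \in A)) => //= fA /(IHt tB)[w [wAB wA wB]].
  by exists (f :: w); rewrite /= inE fB orbT (negbTE fA) wB.
move=> /= /andP[eA sA]; elim: t => [|f t IHt] /=.
  rewrite inE eA /=; case: (boolP (e \in B)) => //= eB _.
  move=> /(IHs [::] sA isT)[w [wAB wA wB]].
  by exists (e :: w); rewrite /= inE eA (negbTE eB) wA.
move=> /andP[fB tB].
case: (boolP (e \in B)) => eB; last first.
  (* [e] is private to the first word *)
  rewrite {1}inE (negbTE eB) andbF => eq_st.
  have [w [wAB wA wB]] := IHs (f :: t) sA (introT andP (conj fB tB)) eq_st.
  by exists (e :: w); rewrite /= inE eA (negbTE eB) wA.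
case: (boolP (f \in A)) => fA; last first.
  (* [f] is private to the second word *)
  rewrite [f \in _]inE (negbTE fA) /= => /(IHt tB)[w [wAB wA wB]].
  by exists (f :: w); rewrite /= inE fB orbT (negbTE fA) wB.
rewrite !inE eA eB fA fB /= => -[<- /(IHs t sA tB)[w [wAB wA wB]]].
by exists (e :: w); rewrite /= inE eA eB wA wB.
Qed.

(** * Parallel composition *)

Lemma lparC (E : finType) (A B : {set E}) (M1 M2 : set (seq E)) :
  lpar A B M1 M2 = lpar B A M2 M1.
Proof.
rewrite /lpar finset.setUC; congr (_ `&` _).
by apply/seteqP; split=> w [].
Qed.

Lemma proj_lparl (E : finType) (A B : {set E}) (M1 M2 : set (seq E)) :
    M1 `<=` words A -> M2 `<=` words B ->
  proj A @` lpar A B M1 M2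
  = M1 `&` proj (A :&: B) @^-1` (proj (A :&: B) @` M2).
Proof.
move=> M1A M2B; apply/seteqP; split=> s.
  case=> w [_ [w1 w2]] <-; split=> //=; exists (proj B w) => //.
  by rewrite !proj_sub ?finset.subsetIl ?finset.subsetIr.
case=> M1s [t M2t] /esym eq_st.
have [w [wAB wA wB]] := shuffle_words (M1A _ M1s) (M2B _ M2t) eq_st.
by exists w => //; split=> //=; rewrite wA wB.
Qed.

Lemma proj_lparI (E : finType) (A B : {set E}) (M1 M2 : set (seq E)) :
    M1 `<=` words A -> M2 `<=` words B ->
  proj (A :&: B) @` lpar A B M1 M2
  = (proj (A :&: B) @` M1) `&` (proj (A :&: B) @` M2).
Proof.
move=> M1A M2B; apply/seteqP; split=> s.
  case=> w [_ [w1 w2]] <-; split.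
    by exists (proj A w) => //; rewrite proj_sub ?finset.subsetIl.
  by exists (proj B w) => //; rewrite proj_sub ?finset.subsetIr.
case=> [[v M1v <-]] vM2.
have: (proj A @` lpar A B M1 M2) v by rewrite proj_lparl.
by case=> w Mw <-; exists w; rewrite // proj_sub ?finset.subsetIl.
Qed.

(** For nonconflicting components, membership in the closure of a projection
    of the composition is decided by the component and the trace on the
    common alphabet. *)
Lemma pclosure_proj_lparl (E : finType) (A B : {set E})
    (M1 M2 : set (seq E)) :
    pclosure M1 `<=` words A -> pclosure M2 `<=` words B ->
    nonconflicting A B M1 M2 ->
  pclosure (proj A @` lpar A B M1 M2)
  = pclosure M1 `&` proj (A :&: B) @^-1`
      pclosure (proj (A :&: B) @` lpar A B M1 M2).
Proof.
move=> M1A M2B nc; rewrite !pclosure_proj nc proj_lparl // proj_lparI //.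
apply/seteqP; split=> s [M1s]; last by case.
by move=> sM2; split=> //; split=> //; exists s.
Qed.

Lemma pclosure_proj_lparr (E : finType) (A B : {set E})
    (M1 M2 : set (seq E)) :
    pclosure M1 `<=` words A -> pclosure M2 `<=` words B ->
    nonconflicting A B M1 M2 ->
  pclosure (proj B @` lpar A B M1 M2)
  = pclosure M2 `&` proj (A :&: B) @^-1`
      pclosure (proj (A :&: B) @` lpar A B M1 M2).
Proof.
move=> M1A M2B nc.
have nc' : nonconflicting B A M2 M1.
  by rewrite /nonconflicting lparC nc; exact: lparC.
by rewrite lparC (finset.setIC A B); exact: pclosure_proj_lparl.
Qed.

Lemma lpar_mono (E : finType) (A B : {set E})
    (M1 M2 N1 N2 : set (seq E)) :
  M1 `<=` N1 -> M2 `<=` N2 -> lpar A B M1 M2 `<=` lpar A B N1 N2.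
Proof. by move=> MN1 MN2 w [wAB [/MN1 w1 /MN2 w2]]. Qed.

Lemma lpar_restrict (E : finType) (A B : {set E}) (L C D : set (seq E)) :
  C `<=` D -> lpar A B L C = lpar A B L D `&` proj B @^-1` C.
Proof.
move=> CD; apply/seteqP; split=> w; first by case=> ? [? /[dup] /CD].
by case=> -[wAB [Lw _] Cw].
Qed.

(** * Controllability and normality *)

Lemma normal_sub (E : finType) (M L : set (seq E)) (Q : seq E -> seq E) :
  normal M L Q -> pclosure M `<=` L.
Proof. by move=> nM w; rewrite nM; case. Qed.

Lemma normalP (E : finType) (M L : set (seq E)) (Q : seq E -> seq E) :
  normal M L Q <-> pclosure M `<=` L /\
    (forall v w, pclosure M v -> L w -> Q v = Q w -> pclosure M w).
Proof.
split=> [nM|[ML nM]].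
  split=> [|v w Mv Lw eqQ]; first exact: normal_sub nM.
  by rewrite nM; split=> //; exists v.
apply/seteqP; split=> w; first by move=> Mw; split; [exists w | exact: ML].
by case=> -[v Mv eqQ] Lw; exact: nM eqQ.
Qed.

Lemma controllableP (E : finType) (M L : set (seq E)) (Su : {set E}) :
  controllable M L Su <->
    (forall s u, pclosure M s -> u \in Su -> L (rcons s u) ->
       pclosure M (rcons s u)).
Proof.
split=> [cM s u Ms Suu Lsu|cM w [[s Ms [u Suu <-]]]]; last exact: cM.
by apply: cM; split=> //; exists s => //; exists u.
Qed.

(** Both properties speak of the closure alone, and restrict along any set of
    words common to the language and to the plant. *)
Lemma controllable_restrict (E : finType) (A M L C : set (seq E))
    (Su : {set E}) :
    pclosure M = pclosure A `&` C -> controllable A L Su ->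
  controllable M (L `&` C) Su.
Proof.
move=> eM /controllableP cA; apply/controllableP; rewrite eM.
by move=> s u [As _] Suu [Lsu Csu]; split=> //; exact: cA.
Qed.

Lemma normal_restrict (E : finType) (A M L C : set (seq E))
    (Q : seq E -> seq E) :
  pclosure M = pclosure A `&` C -> normal A L Q -> normal M (L `&` C) Q.
Proof.
move=> eM /normalP[AL nA]; apply/normalP; rewrite eM.
split=> [w [/AL Lw Cw] //|v w [Av _] [Lw Cw] eqQ].
by split=> //; exact: nA eqQ.
Qed.

(** * The supremal controllable and normal sublanguage *)

Lemma supCN_sub (E : finType) (K L : set (seq E)) (Su : {set E})
    (Q : seq E -> seq E) : supCN K L Su Q `<=` K.
Proof. by move=> w [M [MK _ _] /MK[]]. Qed.

Lemma sub_supCN (E : finType) (K L M : set (seq E)) (Su : {set E})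
    (Q : seq E -> seq E) :
  M `<=` K -> controllable M L Su -> normal M L Q -> M `<=` supCN K L Su Q.
Proof.
move=> MK cM nM w Mw; exists M => //; split=> // v Mv.
by split; [exact: MK | exact: (normal_sub nM (pclosure_ext Mv))].
Qed.

(** Prefix closure commutes with unions, so each word of the closure of the
    supremum is in the closure of a single competitor; this is why the
    supremum has the properties of its competitors. *)
Lemma pclosure_supCN (E : finType) (K L : set (seq E)) (Su : {set E})
    (Q : seq E -> seq E) (w : seq E) :
  pclosure (supCN K L Su Q) w <->
    exists M, [/\ M `<=` supCN K L Su Q, controllable M L Su, normal M L Q
                & pclosure M w].
Proof.
split=> [[t [M MF Mt]]|[M [MF _ _ Mw]]]; last exact: pclosure_mono MF _ Mw.
by case: (MF) => _ cM nM; exists M; split=> //; [move=> v; exists M | exists t].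
Qed.

Lemma supCN_controllable (E : finType) (K L : set (seq E)) (Su : {set E})
    (Q : seq E -> seq E) : controllable (supCN K L Su Q) L Su.
Proof.
apply/controllableP => s u /pclosure_supCN[M [MF cM nM Ms]] Suu Lsu.
apply/pclosure_supCN; exists M; split=> //.
by move/controllableP: cM; apply.
Qed.

Lemma supCN_normal (E : finType) (K L : set (seq E)) (Su : {set E})
    (Q : seq E -> seq E) : normal (supCN K L Su Q) L Q.
Proof.
apply/normalP; split=> [w|v w] /pclosure_supCN[M [MF cM nM]].
  exact: normal_sub nM _.
move=> Mv Lw eqQ; apply/pclosure_supCN; exists M; split=> //.
by have /normalP[_ /(_ v w)] := nM; apply.
Qed.

(** * Enlarging the coordinator language *)

(** An uncontrollable event of [Sk] that the larger coordinator language [N]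
    allows is already allowed by the projection of [M], which is controllable
    with respect to a language containing [N]; any other event leaves the
    trace on [Sk] unchanged. *)
Lemma controllable_coordinator (E : finType) (S Sk Su : {set E})
    (L Lk N M : set (seq E)) :
    pclosure N `<=` Lk ->
    controllable (proj Sk @` M) Lk (Sk :&: Su) ->
    controllable (proj (S :|: Sk) @` M)
      (lpar S Sk L (pclosure (proj Sk @` M))) ((S :|: Sk) :&: Su) ->
  controllable (proj (S :|: Sk) @` M) (lpar S Sk L (pclosure N))
    ((S :|: Sk) :&: Su).
Proof.
move=> NLk /controllableP ck /controllableP c; apply/controllableP.
move=> s u Ms Suu [wsu [Lsu Nsu]]; apply: c => //; split=> //; split=> //=.
have kMs : pclosure (proj Sk @` M) (proj Sk s).
  move: Ms; rewrite !pclosure_proj => -[w Mw <-]; exists w => //.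
  by rewrite proj_sub ?finset.subsetUr.
move: Nsu; rewrite /= proj_rcons; case: ifP => // uSk /NLk; apply: ck => //.
by move: Suu; rewrite !inE uSk => /andP[].
Qed.

(** Words with the same observation have traces on [Sk] with the same
    observation, so that normality of the projection to [Sk] transfers the
    trace condition from one word to the other. *)
Lemma normal_coordinator (E : finType) (S Sk So : {set E})
    (L Lk N M : set (seq E)) :
    pclosure N `<=` Lk -> proj Sk @` M `<=` N ->
    normal (proj Sk @` M) Lk (proj (Sk :&: So)) ->
    normal (proj (S :|: Sk) @` M) (lpar S Sk L (pclosure (proj Sk @` M)))
      (proj ((S :|: Sk) :&: So)) ->
  normal (proj (S :|: Sk) @` M) (lpar S Sk L (pclosure N))
    (proj ((S :|: Sk) :&: So)).
Proof.
move=> NLk MN /normalP[_ nk] /normalP[ML n]; apply/normalP; split.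
  by move=> w /ML; apply: lpar_mono => //; exact: pclosure_mono.
move=> v w Mv [ww [Lw Nw]] eqQ; apply: (n v) => //; split=> //; split=> //=.
have [_ [_ kMv]] := ML _ Mv; apply: nk kMv (NLk _ Nw) _.
rewrite !proj_sub ?finset.subsetIl //.
have obs : Sk :&: So \subset (S :|: Sk) :&: So.
  by rewrite finset.setSI ?finset.subsetUr.
by rewrite -(proj_sub v obs) eqQ proj_sub.
Qed.

Unset Implicit Arguments.

(** * The supremal conditionally controllable and conditionally normal sublanguage *)

Theorem theorem18 (E : finType) (S1 S2 Sk Sc Su So : {set E})
    (S1_neq0 : S1 != finset.set0) (S2_neq0 : S2 != finset.set0)
    (Sk_neq0 : Sk != finset.set0)
    (S12k : S1 :&: S2 \subset Sk) (Sk12 : Sk \subset S1 :|: S2)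
    (Scu : Sc :|: Su = S1 :|: S2) (Scu_disj : Sc :&: Su = finset.set0)
    (So12 : So \subset S1 :|: S2)
    (G1 : generator S1) (G2 : generator S2) (Gk : generator Sk)
    (K : set (seq E))
    (K_reg : regular_lang (S1 :|: S2) K)
    (K_sub : K `<=` mlang (gpar (gpar G1 G2) Gk))
    (K_dec : cond_decomposable S1 S2 Sk K)
    (Kbar_dec : cond_decomposable S1 S2 Sk (pclosure K)) :
  let supCNk :=
    supCN (proj Sk @` K) (lang Gk) (Sk :&: Su) (proj (Sk :&: So)) in
  let supCN1k :=
    supCN (proj (S1 :|: Sk) @` K) (lpar S1 Sk (lang G1) (pclosure supCNk))
      ((S1 :|: Sk) :&: Su) (proj ((S1 :|: Sk) :&: So)) in
  let supCN2k :=
    supCN (proj (S2 :|: Sk) @` K) (lpar S2 Sk (lang G2) (pclosure supCNk))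
      ((S2 :|: Sk) :&: Su) (proj ((S2 :|: Sk) :&: So)) in
  nonconflicting (S1 :|: Sk) (S2 :|: Sk) supCN1k supCN2k ->
  controllable ((proj Sk @` supCN1k) `&` (proj Sk @` supCN2k))
    (lang Gk) (Sk :&: Su) ->
  normal ((proj Sk @` supCN1k) `&` (proj Sk @` supCN2k))
    (lang Gk) (proj (Sk :&: So)) ->
  lpar (S1 :|: Sk) (S2 :|: Sk) supCN1k supCN2k
  = supcCN Su So G1 G2 Gk K.
Proof.
set N := supCN _ _ _ _ => /=.
set A1 := supCN _ (lpar S1 Sk _ _) _ _.
set A2 := supCN _ (lpar S2 Sk _ _) _ _.
set T1 := S1 :|: Sk; set T2 := S2 :|: Sk.
have T12 : T1 :&: T2 = Sk by rewrite -finset.setUIl; apply/finset.setUidPr.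
have T12U : T1 :|: T2 = S1 :|: S2.
  by rewrite finset.setUACA finset.setUid; apply/finset.setUidPl.
have NLk : pclosure N `<=` lang Gk by apply: normal_sub; exact: supCN_normal.
have A1L : pclosure A1 `<=` lpar S1 Sk (lang G1) (pclosure N).
  by apply: normal_sub; exact: supCN_normal.
have A2L : pclosure A2 `<=` lpar S2 Sk (lang G2) (pclosure N).
  by apply: normal_sub; exact: supCN_normal.
have A1w : pclosure A1 `<=` words T1 by move=> w /A1L[].
have A2w : pclosure A2 `<=` words T2 by move=> w /A2L[].
move=> nc ck nk; apply/seteqP; split=> w.
  set M := lpar T1 T2 A1 A2 => Mw.
  have MK : M `<=` K.
    by rewrite K_dec; apply: lpar_mono; exact: supCN_sub.
  have kM : proj Sk @` M = (proj Sk @` A1) `&` (proj Sk @` A2).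
    rewrite -T12; apply: proj_lparI => v Av.
      exact: A1w (pclosure_ext Av).
    exact: A2w (pclosure_ext Av).
  (* words of [A1] already have their trace on [Sk] in the closure of [N] *)
  have kMN : pclosure (proj Sk @` M) `<=` pclosure N.
    rewrite pclosure_proj nc => _ [v [_ [/A1L[_ [_ Nv]] _]] <-].
    by move: Nv; rewrite /= proj_sub ?finset.subsetUr.
  have eM1 : pclosure (proj T1 @` M)
      = pclosure A1 `&` proj Sk @^-1` pclosure (proj Sk @` M).
    by rewrite -T12; exact: pclosure_proj_lparl.
  have eM2 : pclosure (proj T2 @` M)
      = pclosure A2 `&` proj Sk @^-1` pclosure (proj Sk @` M).
    by rewrite -T12; exact: pclosure_proj_lparr.
  exists M => //; split=> //; first exact: subset_trans MK K_sub.
    split; first by rewrite kM.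
      rewrite (lpar_restrict _ _ _ kMN).
      by apply: controllable_restrict eM1 _; exact: supCN_controllable.
    rewrite (lpar_restrict _ _ _ kMN).
    by apply: controllable_restrict eM2 _; exact: supCN_controllable.
  split; first by rewrite kM.
    rewrite (lpar_restrict _ _ _ kMN).
    by apply: normal_restrict eM1 _; exact: supCN_normal.
  rewrite (lpar_restrict _ _ _ kMN).
  by apply: normal_restrict eM2 _; exact: supCN_normal.
case=> M [MK _ [cMk cM1 cM2] [nMk nM1 nM2]] Mw.
have MN : proj Sk @` M `<=` N by apply: sub_supCN => //; exact: image_subset.
have MA1 : proj T1 @` M `<=` A1.
  apply: sub_supCN; first exact: image_subset.
    exact: controllable_coordinator NLk cMk cM1.
  exact: normal_coordinator NLk MN nMk nM1.
have MA2 : proj T2 @` M `<=` A2.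
  apply: sub_supCN; first exact: image_subset.
    exact: controllable_coordinator NLk cMk cM2.
  exact: normal_coordinator NLk MN nMk nM2.
split; first by have := MK _ Mw; rewrite K_dec => -[].
by split; [apply: MA1 | apply: MA2]; exists w.
Qed.
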